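(* Let $L$ be a linear formula of $\mathrm{DIAL}$ and let $t$ be a $\lambda$-term such that $;\vdash t:\mathbf{W}_{\mathrm{Church}}\Rightarrow L$ is derivable. Then there exists a polynomial $P$ such that for every $w\in\{0,1\}^*$, $t\,\underline{w}\Downarrow$ and $Time(t\,\underline{w})\le P(|w|)$.
   Context: $\lambda$-terms $t::=x\mid\lambda x.t\mid tu$; values are variables and abstractions; size $|x|=1$, $|\lambda x.t|=|t|+1$, $|tu|=|t|+|u|$. Weak call-by-value reduction: $(\lambda x.t)v\to t[v/x]$ for $v$ a value, closed under $t_1\to t_2\Rightarrow t_1u\to t_2u,\ ut_1\to ut_2$. A step $t\to u$ costs $\max\{|u|-|t|,1\}$; costs add along reductions. $t\Downarrow$ means $t$ reduces to a value, and $Time(t)$ is the total cost of that reduction. $|w|$ is the length of $w$. DIAL: linear formulas $L::=\alpha\mid\forall\alpha L\mid\mu\alpha L\mid L\multimap M$ ($\mu\alpha L$ only when $\alpha$ occurs only positively in $L$); formulas $A::=L\mid\forall\alpha A\mid L\multimap B\mid A\Rightarrow B$. Judgments $\Gamma;\Delta\vdash t:A$, $\Delta$ assigning linear formulas, variables distinct. Rules: (ax1) $x:A;\vdash x:A$; (ax2) $;x:L\vdash x:L$; ($\mu_e$)/($\mu_i$) pass between $t:\mu\alpha L$ and $t:L[\mu\alpha L/\alpha]$; ($\forall_i$) $t:A\leadsto t:\forall\alpha A$ if $\alpha$ not free in $\Gamma,\Delta$; ($\forall_e$) $t:\forall\alpha A\leadsto t:A[L/\alpha]$, $L$ linear; ($\Rightarrow_e$)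 from $\Gamma_1;\Delta\vdash t:A\Rightarrow B$ and $\Gamma_2;\vdash u:A$ infer $\Gamma_1,\Gamma_2;\Delta\vdash tu:B$; ($\Rightarrow_i$) from $\Gamma,z:A;\Delta\vdash t:B$ infer $\Gamma;\Delta\vdash\lambda z.t:A\Rightarrow B$; ($\multimap_e$) from $\Gamma_1;\Delta_1\vdash t:L\multimap B$ and $\Gamma_2;\Delta_2\vdash u:L$ infer $\Gamma_1,\Gamma_2;\Delta_1,\Delta_2\vdash tu:B$; ($\multimap_i$) from $\Gamma;\Delta,z:L\vdash t:B$ infer $\Gamma;\Delta\vdash\lambda z.t:L\multimap B$; (Contr) from $\Gamma,x:A,y:A;\Delta\vdash t:B$ infer $\Gamma,z:A;\Delta\vdash t[z/x,z/y]:B$; (Derel) from $\Gamma;\Delta,x:L\vdash t:B$ infer $\Gamma,x:L;\Delta\vdash t:B$; (Weak) from $\Gamma;\Delta\vdash t:B$ infer $\Gamma,\Gamma';\Delta,\Delta'\vdash t:B$. $\mathbf{W}_{\mathrm{Church}}=\forall\alpha(\alpha\multimap\alpha)\Rightarrow(\alpha\multimap\alpha)\Rightarrow(\alpha\multimap\alpha)$, $\underline{w}=\lambda f_0f_1x.f_{i_1}(\cdots f_{i_n}(x)\cdots)$ for $w=i_1\cdots i_n$. *)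

(* Defs.v *)
From HB Require Import structures.
From mathcomp Require Import all_boot.

Set Implicit Arguments.
Unset Strict Implicit.
Unset Printing Implicit Defensive.

Definition scons {T : Type} (a : T) (f : nat -> T) (n : nat) : T :=
  if n is m.+1 then f m else a.

Definition up_ren (r : nat -> nat) : nat -> nat := scons 0 (fun n => (r n).+1).

(* Lambda-terms modulo alpha-equivalence, in de Bruijn form.  An index that
   points outside all the abstractions is a free variable, and the free
   variable [n] is used as a variable named [n]: contexts and the operator
   [lam] below refer to free variables by these names. *)
Inductive term : Type :=
  | Var of nat
  | Lam of term
  | App of term & term.

Fixpoint ren (r : nat -> nat) (t : term) : term :=
  match t with
  | Var n => Var (r n)
  | Lam t => Lam (ren (up_ren r) t)
  | App t u => App (ren r t) (ren r u)
  end.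

Definition up (s : nat -> term) : nat -> term :=
  scons (Var 0) (fun n => ren S (s n)).

Fixpoint subst (s : nat -> term) (t : term) : term :=
  match t with
  | Var n => s n
  | Lam t => Lam (subst (up s) t)
  | App t u => App (subst s t) (subst s u)
  end.

(* The term written "lambda z. t" with the named variable [z]: its free
   occurrences become index 0, the other free variables are shifted past the
   new binder. *)
Definition lam (z : nat) (t : term) : term :=
  Lam (ren (fun n => if n == z then 0 else n.+1) t).

(* t[z/x, z/y] *)
Definition contract (x y z : nat) (t : term) : term :=
  ren (fun n => if (n == x) || (n == y) then z else n) t.

Definition is_value (t : term) : bool :=
  if t is App _ _ then false else true.

Fixpoint tsize (t : term) : nat :=
  match t with
  | Var _ => 1
  | Lam t => (tsize t).+1
  | App t u => tsize t + tsize u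
  end.

Inductive step : term -> term -> Prop :=
  | step_beta t v : is_value v -> step (App (Lam t) v) (subst (scons v Var) t)
  | step_appl t1 t2 u : step t1 t2 -> step (App t1 u) (App t2 u)
  | step_appr u t1 t2 : step t1 t2 -> step (App u t1) (App u t2).

(* Truncated subtraction is harmless here, since the maximum with 1 is taken. *)
Definition step_cost (t u : term) : nat := maxn (tsize u - tsize t) 1.

Inductive reduces : term -> term -> nat -> Prop :=
  | reduces_refl t : reduces t t 0
  | reduces_step t u v k :
      step t u -> reduces u v k -> reduces t v (step_cost t u + k).

Definition converges (t : term) : Prop :=
  exists v k, is_value v /\ reduces t v k.

(* [Time t k]: [k] is the total cost of a reduction of [t] to a value.  By
   [Time_unique] there is at most one such [k]. *)
Definition Time (t : term) (k : nat) : Prop :=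
  exists v, is_value v /\ reduces t v k.

Lemma value_nstep t u : is_value t -> ~ step t u.
Proof. by case: t => // [n|t] _ H; inversion H. Qed.

Lemma step_diamond t u1 u2 : step t u1 -> step t u2 ->
  u1 = u2 \/ exists v, [/\ step u1 v, step u2 v,
    step_cost u1 v = step_cost t u2 & step_cost u2 v = step_cost t u1].
Proof.
move=> s1; elim: s1 u2 => {t u1} [t v vv|t1 t2 u s IH|u t1 t2 s IH] u2 s2.
- inversion s2 as [|? ? ? s|? ? ? s]; subst; first by left.
  + by case: (value_nstep _ s).
  + by case: (value_nstep _ s).
- inversion s2 as [|? t3 ? s'|? ? u' s']; subst.
  + by case: (value_nstep _ s).
  + case: (IH _ s') => [->|[v [sv1 sv2 c1 c2]]]; first by left.
    right; exists (App v u); split; try exact: step_appl.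
      by rewrite /step_cost /= !subnDr.
    by rewrite /step_cost /= !subnDr.
  + right; exists (App t2 u'); split; [exact: step_appr|exact: step_appl| |];
      by rewrite /step_cost /= ?subnDr ?subnDl.
- inversion s2 as [? ? vv|? t3 ? s'|? ? u' s']; subst.
  + by case: (value_nstep vv s).
  + right; exists (App t3 t2); split; [exact: step_appl|exact: step_appr| |];
      by rewrite /step_cost /= ?subnDr ?subnDl.
  + case: (IH _ s') => [->|[v [sv1 sv2 c1 c2]]]; first by left.
    right; exists (App u v); split; try exact: step_appr.
      by rewrite /step_cost /= !subnDl.
    by rewrite /step_cost /= !subnDl.
Qed.

Lemma reduces_value_step t v k u : is_value v -> reduces t v k -> step t u ->
  exists2 k', reduces u v k' & k = step_cost t u + k'.
Proof.
move=> vv r; elim: r vv u => {t v k} [t|t u0 v k s0 r IH] vv u s.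
  by case: (value_nstep vv s).
case: (step_diamond s0 s) => [<-|[w [s1 s2 c1 c2]]]; first by exists k.
have [k' r' ->] := IH vv _ s1.
exists (step_cost u w + k'); first exact: reduces_step r'.
by rewrite c1 c2 addnCA.
Qed.

Lemma Time_unique t k1 k2 : Time t k1 -> Time t k2 -> k1 = k2.
Proof.
move=> [v1 [vv1 r1]] [v2 [vv2 r2]].
elim: r1 vv1 k2 r2 => {t v1 k1} [t|t u v1 k s r IH] vv1 k2 r2.
  by case: r2 vv1 => // ? ? ? ? s _ /value_nstep; move/(_ _ s).
by have [k' r' ->] := reduces_value_step vv2 r2 s; rewrite (IH vv1 _ r').
Qed.

(* Raw formulas, with de Bruijn indices for the variables bound by [All] and
   [Mu]; the two syntactic classes are carved out by [is_linear] and
   [is_formula]. *)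
Inductive preformula : Type :=
  | TVar of nat
  | All of preformula
  | Mu of preformula
  | Lolli of preformula & preformula
  | Arrow of preformula & preformula.

Lemma preformula_comparable : comparable preformula.
Proof. by rewrite /comparable /decidable; do 2!decide equality. Qed.

HB.instance Definition _ := hasDecEq.Build preformula (compareP preformula_comparable).

Fixpoint tren (r : nat -> nat) (A : preformula) : preformula :=
  match A with
  | TVar n => TVar (r n)
  | All A => All (tren (up_ren r) A)
  | Mu A => Mu (tren (up_ren r) A)
  | Lolli A B => Lolli (tren r A) (tren r B)
  | Arrow A B => Arrow (tren r A) (tren r B)
  end.

Definition tup (s : nat -> preformula) : nat -> preformula :=
  scons (TVar 0) (fun n => tren S (s n)).

Fixpoint tsubst (s : nat -> preformula) (A : preformula) : preformula :=
  match A with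
  | TVar n => s n
  | All A => All (tsubst (tup s) A)
  | Mu A => Mu (tsubst (tup s) A)
  | Lolli A B => Lolli (tsubst s A) (tsubst s B)
  | Arrow A B => Arrow (tsubst s A) (tsubst s B)
  end.

(* A[L/alpha], where alpha is the variable of index 0 of [A]. *)
Definition tinst (A L : preformula) : preformula := tsubst (scons L TVar) A.

(* Every free occurrence of the variable [k] in [A] has polarity [b]
   ([true] for positive). *)
Fixpoint occurs_only (b : bool) (k : nat) (A : preformula) : bool :=
  match A with
  | TVar n => (n == k) ==> b
  | All A => occurs_only b k.+1 A
  | Mu A => occurs_only b k.+1 A
  | Lolli A B => occurs_only (~~ b) k A && occurs_only b k B
  | Arrow A B => occurs_only (~~ b) k A && occurs_only b k B
  end.

Fixpoint is_linear (A : preformula) : bool :=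
  match A with
  | TVar _ => true
  | All A => is_linear A
  | Mu A => is_linear A && occurs_only true 0 A
  | Lolli A B => is_linear A && is_linear B
  | Arrow _ _ => false
  end.

Fixpoint is_formula (A : preformula) : bool :=
  is_linear A ||
  match A with
  | All A => is_formula A
  | Lolli A B => is_linear A && is_formula B
  | Arrow A B => is_formula A && is_formula B
  | _ => false
  end.

Definition ctx : Type := seq (nat * preformula).

Definition shift_ctx (G : ctx) : ctx := [seq (xA.1, tren S xA.2) | xA <- G].

Definition distinct (G D : ctx) : bool := uniq (unzip1 (G ++ D)).

(* Contexts are lists read up to permutation, hence the rule [dial_exch].
   Distinctness and well-formedness are only required where they do not follow
   from the premises.  In [dial_alli], the bound variable is index 0 of [A],
   and it is not free in the contexts because these are shifted. *)
Inductive dial : ctx -> ctx -> term -> preformula -> Prop :=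
  | dial_ax1 x A :
      is_formula A -> dial [:: (x, A)] [::] (Var x) A
  | dial_ax2 x L :
      is_linear L -> dial [::] [:: (x, L)] (Var x) L
  | dial_mue G D t L :
      dial G D t (Mu L) -> dial G D t (tinst L (Mu L))
  | dial_mui G D t L :
      is_linear (Mu L) ->
      dial G D t (tinst L (Mu L)) -> dial G D t (Mu L)
  | dial_alli G D t A :
      dial (shift_ctx G) (shift_ctx D) t A -> dial G D t (All A)
  | dial_alle G D t A L :
      is_linear L -> dial G D t (All A) -> dial G D t (tinst A L)
  | dial_arrowe G1 G2 D t u A B :
      distinct (G1 ++ G2) D ->
      dial G1 D t (Arrow A B) -> dial G2 [::] u A ->
      dial (G1 ++ G2) D (App t u) B
  | dial_arrowi G D z t A B :
      dial (rcons G (z, A)) D t B -> dial G D (lam z t) (Arrow A B)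
  | dial_lollie G1 G2 D1 D2 t u L B :
      distinct (G1 ++ G2) (D1 ++ D2) ->
      dial G1 D1 t (Lolli L B) -> dial G2 D2 u L ->
      dial (G1 ++ G2) (D1 ++ D2) (App t u) B
  | dial_lollii G D z t L B :
      dial G (rcons D (z, L)) t B -> dial G D (lam z t) (Lolli L B)
  | dial_contr G D x y z t A B :
      distinct (rcons G (z, A)) D ->
      dial (G ++ [:: (x, A); (y, A)]) D t B ->
      dial (rcons G (z, A)) D (contract x y z t) B
  | dial_derel G D x t L B :
      dial G (rcons D (x, L)) t B -> dial (rcons G (x, L)) D t B
  | dial_weak G G' D D' t B :
      distinct (G ++ G') (D ++ D') ->
      all is_formula (unzip2 G') -> all is_linear (unzip2 D') ->
      dial G D t B -> dial (G ++ G') (D ++ D') t B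
  | dial_exch G G' D D' t B :
      perm_eq G G' -> perm_eq D D' -> dial G D t B -> dial G' D' t B.

Definition W_Church : preformula :=
  let E := Lolli (TVar 0) (TVar 0) in All (Arrow E (Arrow E E)).

(* Under the three binders f_0, f_1, x, the indices of f_0, f_1 and x are 2, 1
   and 0; the letters 0 and 1 are [false] and [true]. *)
Definition church (w : seq bool) : term :=
  Lam (Lam (Lam
    (foldr (fun (i : bool) u => App (Var (if i then 1 else 2)) u) (Var 0) w))).

(* Main.v *)
From HB Require Import structures.
From mathcomp Require Import all_boot ssralg poly zify.
Require Import Defs.

Set Implicit Arguments.
Unset Strict Implicit.
Unset Printing Implicit Defensive.

(* The proof is by realizability, with budgets in place of mere termination.  A
   linear formula is interpreted as a set of pairs (value, budget), the budget
   paying for all future reductions and bounding the size; budgets add up under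
   application, and since linear variables occur at most once, passing a linear
   argument costs a single step.  Quantified and fixpoint formulas are handled
   by impredicative intersection and Knaster-Tarski.  An arrow [A => B] may
   duplicate its argument, so its realizers also come with a function telling
   the budget of the result from that of the argument.  Because quantifiers
   only range over linear formulas, these functions live in a simple type
   hierarchy over the base type of budgets, which we take to be polynomials in
   the length [n] of the input word.  A Church numeral of length [n] realizes
   its type with functions that are polynomial in ['X] uniformly in the word,
   hence so is the budget of [t] applied to it. *)

(** * Renaming and substitution *)

Lemma ren_ren r r' r'' t :
  (forall n, r (r' n) = r'' n) -> ren r (ren r' t) = ren r'' t.
Proof.
elim: t r r' r'' => [n|t IH|t IHt u IHu] r r' r'' H /=; first by rewrite H.
- by rewrite (IH _ _ (up_ren r'')) // => -[|n] //=; rewrite H.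
- by rewrite (IHt _ _ r'') // (IHu _ _ r'').
Qed.

Lemma subst_ren r s s' t :
  (forall n, s (r n) = s' n) -> subst s (ren r t) = subst s' t.
Proof.
elim: t r s s' => [n|t IH|t IHt u IHu] r s s' H /=; first exact: H.
- by rewrite (IH _ _ (up s')) // => -[|n] //=; rewrite H.
- by rewrite (IHt _ _ s') // (IHu _ _ s').
Qed.

Lemma ren_subst r s s' t :
  (forall n, ren r (s n) = s' n) -> ren r (subst s t) = subst s' t.
Proof.
elim: t r s s' => [n|t IH|t IHt u IHu] r s s' H /=; first exact: H.
- rewrite (IH _ _ (up s')) // => -[|n] //=.
  rewrite -H (@ren_ren _ _ (fun n => (r n).+1)) //.
  by rewrite (@ren_ren S r (fun n => (r n).+1)).
- by rewrite (IHt _ _ s') // (IHu _ _ s').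
Qed.

Lemma subst_subst s s' s'' t :
  (forall n, subst s (s' n) = s'' n) -> subst s (subst s' t) = subst s'' t.
Proof.
elim: t s s' s'' => [n|t IH|t IHt u IHu] s s' s'' H /=; first exact: H.
- rewrite (IH _ _ (up s'')) // => -[|n] //=.
  rewrite -H (@subst_ren _ _ (fun n => ren S (s n))) //.
  by rewrite (@ren_subst _ _ (fun n => ren S (s n))).
- by rewrite (IHt _ _ s'') // (IHu _ _ s'').
Qed.

Lemma subst_id s t : (forall n, s n = Var n) -> subst s t = t.
Proof.
elim: t s => [n|t IH|t IHt u IHu] s H /=; first exact: H.
- by rewrite IH // => -[|n] //=; rewrite H.
- by rewrite IHt // IHu.
Qed.

(** * Sizes under substitution *)

(** Free variables carry the sizes of the terms to be substituted for them, bound ones keep size 1.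
    Comparing the sizes of two instances of a term thus becomes comparing two weight functions. *)
Fixpoint wsize (w : nat -> nat) (t : term) : nat :=
  match t with
  | Var n => w n
  | Lam t => (wsize (scons 1 w) t).+1
  | App t u => wsize w t + wsize w u
  end.

Lemma wsize_ren r w w' t :
  (forall n, w (r n) = w' n) -> wsize w (ren r t) = wsize w' t.
Proof.
elim: t r w w' => [n|t IH|t IHt u IHu] r w w' H /=; first exact: H.
- by rewrite (IH _ _ (scons 1 w')) // => -[|n] //=.
- by rewrite (IHt _ _ w') // (IHu _ _ w').
Qed.

Lemma wsize1 w t : (forall n, w n = 1) -> wsize w t = tsize t.
Proof.
elim: t w => [n|t IH|t IHt u IHu] w H /=; first exact: H.
- by rewrite IH // => -[|n] /=.
- by rewrite IHt // IHu.
Qed.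

Lemma tsize_ren r t : tsize (ren r t) = tsize t.
Proof. by rewrite -(@wsize1 (fun=> 1)) // (@wsize_ren _ _ (fun=> 1)) // wsize1. Qed.

Lemma tsize_subst s w t :
  (forall n, tsize (s n) = w n) -> tsize (subst s t) = wsize w t.
Proof.
elim: t s w => [n|t IH|t IHt u IHu] s w H /=; first exact: H.
- by rewrite (IH _ (scons 1 w)) // => -[|n] //=; rewrite tsize_ren.
- by rewrite (IHt _ w) // (IHu _ w).
Qed.

(** A term has at most [tsize t] variable occurrences, and each gains at most [a]. *)
Lemma wsize_lipschitz a w w' t :
  (forall n, w n <= w' n + a) -> wsize w t <= wsize w' t + tsize t * a.
Proof.
elim: t w w' => [n|t IH|t IHt u IHu] w w' H /=; first by rewrite mul1n.
- have /IH : forall n, scons 1 w n <= scons 1 w' n + a by case=> //=; lia.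
  by lia.
- by move: (IHt _ _ H) (IHu _ _ H); lia.
Qed.

Lemma wsize_const m w t : 0 < m -> (forall n, w n <= m) ->
  wsize w t <= tsize t * m.
Proof.
move=> m0; elim: t w => [n|t IH|t IHt u IHu] w H /=; first by rewrite mul1n.
- have /IH : forall n, scons 1 w n <= m by case.
  by lia.
- by move: (IHt _ H) (IHu _ H); lia.
Qed.

(** * Linear occurrences and sizes of typed terms *)

Definition csum (w : nat -> nat) (D : ctx) : nat := \sum_(xA <- D) w xA.1.

Lemma csum_cat w D D' : csum w (D ++ D') = csum w D + csum w D'.
Proof. exact: big_cat. Qed.

Lemma csum_rcons w D x A : csum w (rcons D (x, A)) = csum w D + w x.
Proof. by rewrite -cats1 csum_cat /csum big_seq1. Qed.

Lemma csum_perm w D D' : perm_eq D D' -> csum w D = csum w D'.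
Proof. exact: perm_big. Qed.

Lemma csum_le w w' D :
  (forall x A, (x, A) \in D -> w x <= w' x) -> csum w D <= csum w' D.
Proof.
by move=> H; rewrite /csum !big_seq; apply: leq_sum => -[x A] /H.
Qed.

Lemma csum_eq w w' D :
  (forall x A, (x, A) \in D -> w x = w' x) -> csum w D = csum w' D.
Proof.
by move=> H; rewrite /csum !big_seq; apply: eq_bigr => -[x A] /H.
Qed.

Lemma csum_shift w D : csum w (shift_ctx D) = csum w D.
Proof. by rewrite /csum big_map. Qed.

Lemma leq_csum w D x A : (x, A) \in D -> w x <= csum w D.
Proof.
elim: D => // -[y B] D IH; rewrite inE /csum big_cons /= => /orP[/eqP[-> _]|/IH].
  exact: leq_addr.
by rewrite /csum; lia.
Qed.

Lemma mem_shift x A G : (x, A) \in shift_ctx G ->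
  exists2 B, A = tren S B & (x, B) \in G.
Proof. by case/mapP=> -[y B] yG [-> ->]; exists B. Qed.

Lemma mem_catl (T : eqType) (x : T) (s s' : seq T) : x \in s -> x \in s ++ s'.
Proof. by rewrite mem_cat => ->. Qed.

Lemma mem_catr (T : eqType) (x : T) (s s' : seq T) : x \in s' -> x \in s ++ s'.
Proof. by rewrite mem_cat orbC => ->. Qed.

(* Linear variables occur at most once, so the size is 1-Lipschitz in them. *)
Lemma wsize_linear G D t B w w' : dial G D t B ->
  (forall x A, (x, A) \in G -> w x <= w' x) ->
  wsize w t <= wsize w' t + csum (fun x => w x - w' x) D.
Proof.
move=> T; elim: T w w' => {G D t B}
  [x A _|x L _|G D t L _ IH|G D t L _ _ IH|G D t A _ IH|G D t A L _ _ IH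
  |G1 G2 D t u A B _ _ IHt _ IHu|G D z t A B _ IH
  |G1 G2 D1 D2 t u L B _ _ IHt _ IHu|G D z t L B _ IH
  |G D x y z t A B _ _ IH|G D x t L B _ IH
  |G G' D D' t B _ _ _ _ IH|G G' D D' t B pG pD _ IH] w w' H.
- by rewrite /= (leq_trans (H x A _)) ?leq_addr // mem_head.
- by rewrite /csum big_seq1 /=; lia.
- exact: IH.
- exact: IH.
- by rewrite -csum_shift; apply: IH => x _ /mem_shift[C _ /H].
- exact: IH.
(* The argument has an empty linear context, so its correction term vanishes. *)
- have Ht := IHt w w' (fun x C xG => H x C (mem_catl _ xG)).
  have Hu := IHu w w' (fun x C xG => H x C (mem_catr _ xG)).
  by move: Ht Hu; rewrite {2}/csum big_nil /=; lia.
- pose e (w : nat -> nat) n := if n == z then 1 else w n.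
  rewrite /= (@wsize_ren _ _ (e w)) ?(@wsize_ren _ _ (e w'));
    try by move=> n; rewrite /e; case: ifP.
  rewrite addSn ltnS; apply: leq_trans (IH _ (e w') _) _.
    move=> x C; rewrite mem_rcons inE /e => /orP[/eqP[-> _]|xG].
      by rewrite eqxx.
    by case: ifP => // _; apply: H xG.
  rewrite leq_add2l; apply: csum_le => x C _; rewrite /e; case: ifP => //; lia.
- have Ht := IHt w w' (fun x C xG => H x C (mem_catl _ xG)).
  have Hu := IHu w w' (fun x C xG => H x C (mem_catr _ xG)).
  by move: Ht Hu; rewrite csum_cat /=; lia.
(* Under the abstraction [z] has weight 1 on both sides, so it contributes nothing to the correction
   sum. *)
- pose e (w : nat -> nat) n := if n == z then 1 else w n.
  rewrite /= (@wsize_ren _ _ (e w)) ?(@wsize_ren _ _ (e w'));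
    try by move=> n; rewrite /e; case: ifP.
  rewrite addSn ltnS; apply: leq_trans (IH _ (e w') _) _.
    by move=> x C xG; rewrite /e; case: eqP => // _; apply: H xG.
  rewrite leq_add2l csum_rcons /e eqxx subnn addn0.
  by apply: csum_le => x C _; case: ifP => //; lia.
- pose e (w : nat -> nat) n := w (if (n == x) || (n == y) then z else n).
  rewrite /contract (@wsize_ren _ _ (e w)) ?(@wsize_ren _ _ (e w')) //.
  have Hz : w z <= w' z by apply: (H z A); rewrite mem_rcons mem_head.
  apply: leq_trans (IH _ (e w') _) _.
    move=> u C; rewrite mem_cat !inE /e => /orP[uG|/orP[]/eqP[-> _]].
    + by case: ifP => // _; apply: (H u C); rewrite mem_rcons inE uG orbT.
    + by rewrite eqxx.
    + by rewrite eqxx orbT.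
  rewrite leq_add2l; apply: csum_le => u C _; rewrite /e; case: ifP => //; lia.
- have Hx : w x <= w' x by apply: (H x L); rewrite mem_rcons mem_head.
  apply: leq_trans (IH w w' _) _.
    by move=> u C uG; apply: (H u C); rewrite mem_rcons inE uG orbT.
  by rewrite csum_rcons; lia.
- apply: leq_trans (IH w w' _) _.
    by move=> u C uG; apply: (H u C); rewrite mem_cat uG.
  by rewrite csum_cat; lia.
- rewrite -(csum_perm _ pD); apply: IH => x C.
  by rewrite (perm_mem pG); apply: H.
Qed.

(** The constant weight [m] dominates every intuitionistic variable and bounds the whole term by
    [tsize t * m]; the excess of the linear variables over [m] is paid once each, by
    [wsize_linear]. *)
Lemma wsize_ctx G D t B w : dial G D t B ->
  wsize w t <= tsize t * (1 + csum w G) + csum w D.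
Proof.
move=> T; set m := 1 + _.
apply: leq_trans (wsize_linear (w' := fun=> m) T _) _.
  by move=> x A /(leq_csum w); rewrite /m; lia.
rewrite leq_add ?wsize_const //; apply: csum_le => x A _; exact: leq_subr.
Qed.

(** * Substitution in formulas and well-formedness of judgments *)

Lemma occurs_only_tren b j k r A : (forall m, (r m == j) = (m == k)) ->
  occurs_only b j (tren r A) = occurs_only b k A.
Proof.
elim: A b j k r => [n|A IH|A IH|A IHA B IHB|A IHA B IHB] b j k r H /=.
- by rewrite H.
- by rewrite (IH _ _ k.+1) // => -[|m] //=; rewrite eqSS H.
- by rewrite (IH _ _ k.+1) // => -[|m] //=; rewrite eqSS H.
- by rewrite (IHA _ _ k) // (IHB _ _ k).
- by rewrite (IHA _ _ k) // (IHB _ _ k).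
Qed.

Lemma occurs_only_tren_notin b j r A : (forall m, r m != j) ->
  occurs_only b j (tren r A).
Proof.
elim: A b j r => [n|A IH|A IH|A IHA B IHB|A IHA B IHB] b j r H /=.
- by rewrite (negbTE (H n)).
- by apply: IH => -[|m] //=; rewrite eqSS.
- by apply: IH => -[|m] //=; rewrite eqSS.
- by rewrite IHA ?IHB.
- by rewrite IHA ?IHB.
Qed.

(** This keeps [Mu] well-formed under substitution: a lifted substitution fixes the bound variable,
    which does not occur in the other, shifted images. *)
Lemma occurs_only_tsubst b k s A : s k = TVar k ->
  (forall m c, m != k -> occurs_only c k (s m)) ->
  occurs_only b k A -> occurs_only b k (tsubst s A).
Proof.
elim: A b k s => [n|A IH|A IH|A IHA B IHB|A IHA B IHB] b k s Hk H /=.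
- by have [->|nk _] := eqVneq n k; [rewrite Hk /= eqxx | exact: H].
- apply: IH => [|[|m] c] //=; first by rewrite Hk.
  by rewrite eqSS => mk; rewrite (@occurs_only_tren _ _ k) ?H.
- apply: IH => [|[|m] c] //=; first by rewrite Hk.
  by rewrite eqSS => mk; rewrite (@occurs_only_tren _ _ k) ?H.
- by case/andP=> ? ?; rewrite IHA ?IHB.
- by case/andP=> ? ?; rewrite IHA ?IHB.
Qed.

Lemma is_linear_tren r A : is_linear (tren r A) = is_linear A.
Proof.
elim: A r => [n|A IH|A IH|A IHA B IHB|A IHA B IHB] r //=.
- by rewrite IH (@occurs_only_tren _ _ 0) // => -[].
- by rewrite IHA IHB.
Qed.

Lemma is_formula_tren r A : is_formula (tren r A) = is_formula A.
Proof.
elim: A r => [n|A IH|A IH|A IHA B IHB|A IHA B IHB] r //=.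
- by rewrite IH is_linear_tren.
- by rewrite is_linear_tren (@occurs_only_tren _ _ 0) // => -[].
- by rewrite IHB !is_linear_tren.
- by rewrite IHB IHA.
Qed.

Lemma is_linear_tup s :
  (forall k, is_linear (s k)) -> forall k, is_linear (tup s k).
Proof. by move=> H [|k] //=; rewrite is_linear_tren. Qed.

Lemma is_linear_tsubst s A :
  (forall k, is_linear (s k)) -> is_linear A -> is_linear (tsubst s A).
Proof.
elim: A s => [n|A IH|A IH|A IHA B IHB|A IHA B IHB] s H //=.
- by apply: IH; apply: is_linear_tup.
- case/andP=> lA pA; rewrite IH ?occurs_only_tsubst //; last exact: is_linear_tup.
  by case=> // m c _ /=; apply: occurs_only_tren_notin.
- by case/andP=> ? ?; rewrite IHA ?IHB.
Qed.

Lemma is_linear_formula A : is_linear A -> is_formula A.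
Proof. by case: A => //= *; apply/orP; left. Qed.

Lemma is_formula_tsubst s A :
  (forall k, is_linear (s k)) -> is_formula A -> is_formula (tsubst s A).
Proof.
elim: A s => [n|A IH|A IH|A IHA B IHB|A IHA B IHB] s H.
- by move=> _; apply: is_linear_formula; apply: H.
- case/orP=> [lA|fA].
    by apply: is_linear_formula; apply: is_linear_tsubst.
  by rewrite /= IH ?orbT //; apply: is_linear_tup.
- rewrite [X in X -> _]/= orbF => lA.
  by apply: is_linear_formula; apply: is_linear_tsubst.
- case/orP=> [lA|/andP[lA fB]].
    by apply: is_linear_formula; apply: is_linear_tsubst.
  by rewrite /= is_linear_tsubst //= IHB ?orbT.
- by case/andP=> ? ?; rewrite /= IHA ?IHB.
Qed.

Lemma is_linear_scons L : is_linear L -> forall k, is_linear (scons L TVar k).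
Proof. by move=> lL []. Qed.

Lemma unzip1_shift G : unzip1 (shift_ctx G) = unzip1 G.
Proof. by rewrite /unzip1 -map_comp. Qed.

Lemma all_unzip2_shift (p : pred preformula) G : (forall A, p (tren S A) = p A) ->
  all p (unzip2 (shift_ctx G)) = all p (unzip2 G).
Proof. by move=> H; rewrite /unzip2 -map_comp !all_map; apply: eq_all => -[]. Qed.

Lemma perm_distinct G G' D D' : perm_eq G G' -> perm_eq D D' ->
  distinct G D = distinct G' D'.
Proof.
by move=> pG pD; apply: perm_uniq; apply: perm_map; apply: perm_cat.
Qed.

Lemma dial_distinct G D t B : dial G D t B -> distinct G D.
Proof.
elim=> {G D t B} //.
- by move=> G D t A _; rewrite /distinct /shift_ctx -map_cat -/(shift_ctx _)
    unzip1_shift.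
- move=> G D z t A B _; rewrite (@perm_distinct _ ((z, A) :: G) _ D) ?perm_rcons //.
  by case/andP.
- move=> G D z t L B _; rewrite /distinct -rcons_cat /unzip1 map_rcons rcons_uniq.
  by case/andP.
- move=> G D x t L B _; rewrite /distinct cat_rcons.
  by rewrite (@perm_uniq _ _ (unzip1 (G ++ (x, L) :: D))) //
    perm_map // perm_cat2l perm_rcons.
- by move=> G G' D D' t B pG pD _; rewrite (perm_distinct pG pD).
Qed.

Lemma perm_unzip2_all (p : pred preformula) (G G' : ctx) :
  perm_eq G G' -> all p (unzip2 G) = all p (unzip2 G').
Proof. by move=> pG; apply: perm_all; apply: perm_map. Qed.

(** The rules check well-formedness only where formulas are introduced; this recovers it for all
    judgments, in particular the linearity of [Mu L] before unfolding and of the left side of a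
    [Lolli]. *)
Lemma dial_wf G D t B : dial G D t B ->
  [/\ all is_formula (unzip2 G), all is_linear (unzip2 D) & is_formula B].
Proof.
elim=> {G D t B}.
- by move=> x A fA; rewrite /= fA.
- by move=> x L lL; rewrite /= lL is_linear_formula.
- move=> G D t L _ [-> -> /=]; rewrite orbF => lL; split=> //.
  apply: is_linear_formula; apply: is_linear_tsubst; last by case/andP: lL.
  exact: is_linear_scons.
- by move=> G D t L lL _ [-> -> _]; split=> //; apply: is_linear_formula.
- move=> G D t A _ []; rewrite !all_unzip2_shift => [||A']; last first.
  + exact: is_formula_tren.
  + exact: is_linear_tren.
  + by move=> -> -> fA; rewrite /= fA orbT.
- move=> G D t A L lL _ [-> -> fA]; split=> //.
  apply: is_formula_tsubst; first exact: is_linear_scons.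
  by case/orP: fA => /= //; apply: is_linear_formula.
- move=> G1 G2 D t u A B _ _ [G1f Df /andP[_ fB]] _ [G2f _ _].
  by rewrite /unzip2 map_cat all_cat -!/(unzip2 _) G1f G2f.
- move=> G D z t A B _ [].
  by rewrite /unzip2 map_rcons all_rcons /= => /andP[-> ->] -> ->.
- move=> G1 G2 D1 D2 t u L B _ _ [G1f D1f fB] _ [G2f D2f _].
  rewrite /unzip2 !map_cat !all_cat -!/(unzip2 _) G1f G2f D1f D2f; split=> //.
  by case/orP: fB => /andP[] // _; apply: is_linear_formula.
- move=> G D z t L B _ [].
  rewrite /unzip2 map_rcons all_rcons /= => -> /andP[-> ->] ->.
  by rewrite orbT.
- move=> G D x y z t A B _ _ [].
  rewrite /unzip2 map_cat all_cat map_rcons all_rcons /=.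
  by case/and3P=> -> -> _ -> ->.
- move=> G D x t L B _ [].
  rewrite /unzip2 !map_rcons !all_rcons /= => -> /andP[/is_linear_formula-> ->].
  by move=> ->.
- move=> G G' D D' t B _ fG' lD' _ [fG lD fB].
  by rewrite /unzip2 !map_cat !all_cat -!/(unzip2 _) fG fG' lD lD'.
- move=> G G' D D' t B pG pD _.
  by rewrite (perm_unzip2_all _ pG) (perm_unzip2_all _ pD).
Qed.

(** * Reductions in context and uniqueness of values *)

Lemma reduces_trans t u v k l :
  reduces t u k -> reduces u v l -> reduces t v (k + l).
Proof.
by elim=> [//|{}t u' {}u {}k s _ IH] /IH r; rewrite -addnA; apply: reduces_step r.
Qed.

Lemma reduces_appl t t' u k : reduces t t' k -> reduces (App t u) (App t' u) k.
Proof.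
elim=> [{}t|{}t t1 {}t' {}k s _ IH]; first exact: reduces_refl.
have -> : step_cost t t1 = step_cost (App t u) (App t1 u).
  by rewrite /step_cost /= subnDr.
exact: reduces_step (step_appl u s) IH.
Qed.

Lemma reduces_appr t u u' k : reduces u u' k -> reduces (App t u) (App t u') k.
Proof.
elim=> [{}u|{}u u1 {}u' {}k s _ IH]; first exact: reduces_refl.
have -> : step_cost u u1 = step_cost (App t u) (App t u1).
  by rewrite /step_cost /= subnDl.
exact: reduces_step (step_appr t s) IH.
Qed.

Lemma value_unique t v v' k k' : is_value v -> is_value v' ->
  reduces t v k -> reduces t v' k' -> v = v' /\ k = k'.
Proof.
move=> vv vv' r; elim: r vv k' => {t v k} [t|t u v k s r IH] vv k' r'.
  by inversion r' as [|? ? ? ? s]; subst => //; case: (value_nstep vv s).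
have [k1 r1 ->] := reduces_value_step vv' r' s.
by have [-> ->] := IH vv _ r1.
Qed.

(** * Candidates and evaluation within a budget *)

Definition cand : Type := term -> nat -> Prop.

(** The largest good candidate; it serves as default instance of quantifiers and free type
    variables. *)
Definition ok (v : term) (q : nat) : Prop := is_value v /\ tsize v <= q.

Definition good (X : cand) : Prop :=
  forall v q, X v q -> ok v q /\ forall q', q <= q' -> X v q'.

(* [q] is a budget: it pays for the evaluation of [t], and what is left is
   available to the value. *)
Definition eval_in (X : cand) (t : term) (q : nat) : Prop :=
  exists v k, [/\ is_value v, reduces t v k, k <= q & X v (q - k)].

Lemma good_ok : good ok.
Proof. by move=> v q [vv sv]; split=> // q' qq'; split=> //; apply: leq_trans qq'. Qed.

Lemma good_scons X (rho : nat -> cand) : good X -> (forall k, good (rho k)) ->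
  forall k, good (scons X rho k).
Proof. by move=> gX gr []. Qed.

Lemma good_le (X : cand) v q q' : good X -> q <= q' -> X v q -> X v q'.
Proof. by move=> gX qq' /gX[_]; apply. Qed.

Lemma eval_in_sub (X Y : cand) t q : (forall v q, X v q -> Y v q) ->
  eval_in X t q -> eval_in Y t q.
Proof. by move=> XY [v [k [vv r kq /XY Yv]]]; exists v, k. Qed.

Lemma eval_in_le X t q q' : good X -> q <= q' -> eval_in X t q -> eval_in X t q'.
Proof.
move=> gX qq' [v [k [vv r kq Xv]]]; exists v, k; split=> //.
  exact: leq_trans qq'.
by apply: good_le Xv => //; apply: leq_sub2r.
Qed.

Lemma eval_in_value (X : cand) v q : good X -> X v q -> eval_in X v q.
Proof.
move=> gX Xv; have [[vv _] _] := gX _ _ Xv.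
by exists v, 0; split=> //; [apply: reduces_refl | rewrite subn0].
Qed.

Lemma eval_in_step X t u c q : good X -> step t u -> step_cost t u <= c ->
  eval_in X u q -> eval_in X t (c + q).
Proof.
move=> gX s sc [v [k [vv r kq Xv]]].
exists v, (step_cost t u + k); split=> //; first exact: reduces_step r.
  by rewrite leq_add.
by apply: good_le Xv => //; lia.
Qed.

(** Function, then argument, are evaluated, and their unspent budgets add up; [e] is extra budget
    for the application itself. The premise offers [r' <= r] so that the argument can be restored to
    its full budget [r] by goodness. *)
Lemma eval_in_app (X Y Z : cand) t u q r e : good Z ->
  eval_in X t q -> eval_in Y u r ->
  (forall v w q' r', r' <= r -> X v q' -> Y w r' ->
    eval_in Z (App v w) (q' + r' + e)) ->
  eval_in Z (App t u) (q + r + e).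
Proof.
move=> gZ [v [k [vv rv kq Xv]]] [w [l [vw rw lr Yw]]].
case/(_ v w _ _ (leq_subr l r) Xv Yw) => v' [m [vv' rm mq Zv']].
exists v', (k + l + m); split=> //; last by apply: good_le Zv' => //; lia.
- apply: reduces_trans rm; apply: reduces_trans (reduces_appl u rv) _.
  exact: reduces_appr.
- by lia.
Qed.

(** By [value_unique] all instances reach the same value at the same cost, so evaluation commutes
    with nonempty intersections. *)
Lemma eval_in_all (I : Type) (P : I -> Prop) (i0 : I) (F : I -> cand) t q : P i0 ->
  (forall i, P i -> eval_in (F i) t q) ->
  eval_in (fun v r => forall i, P i -> F i v r) t q.
Proof.
move=> P0 H; have [v [k [vv r kq _]]] := H _ P0.
exists v, k; split=> // i /H [v' [k' [vv' r' _ Fv']]].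
by have [-> ->] := value_unique vv vv' r r'.
Qed.

(** * Shapes and the realizability interpretation *)

Inductive shape : Type := Base | Fun of shape & shape.

Lemma shape_comparable : comparable shape.
Proof. by rewrite /comparable /decidable; decide equality. Qed.

HB.instance Definition _ := hasDecEq.Build shape (compareP shape_comparable).

(** Quantifiers and linear arguments leave no trace, so instantiating a quantifier by a linear
    formula preserves the shape. *)
Fixpoint shape_of (A : preformula) : shape :=
  match A with
  | TVar _ | Mu _ => Base
  | All A => shape_of A
  | Lolli _ B => shape_of B
  | Arrow A B => Fun (shape_of A) (shape_of B)
  end.

(** A function receives the datum and budget of its argument and returns the datum of the result
    with the budget to be added for the call. *)
Fixpoint dom (s : shape) : Type :=
  if s is Fun s1 s2 then dom s1 * {poly nat} -> dom s2 * {poly nat} else unit.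

Fixpoint dom0 (s : shape) : dom s :=
  if s is Fun s1 s2 then fun=> (dom0 s2, 0%R) else tt.

Definition ev (n : nat) (p : {poly nat}) : nat := (p.[n])%R.

(* A linear formula has shape [Base]: its realizers carry no other data than
   their budget. *)
Fixpoint realizes (n : nat) (A : preformula) (rho : nat -> cand) (s : shape) :
    dom s -> cand :=
  match A with
  | TVar k => fun _ => rho k
  | All A => fun d v q =>
      forall X, good X -> realizes n A (scons X rho) d v q
  | Mu A => fun _ v q => forall X, good X /\
      (forall u r, @realizes n A (scons X rho) Base tt u r -> X u r) -> X v q
  | Lolli A B => fun d v q => ok v q /\
      forall u r, @realizes n A rho Base tt u r ->
        eval_in (realizes n B rho d) (App v u) (q + r)
  | Arrow A B =>
      match s with
      | Base => fun _ _ _ => False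
      | Fun s1 s2 => fun d v q => ok v q /\
          forall u (y : dom s1 * {poly nat}),
            realizes n A rho y.1 u (ev n y.2) ->
            eval_in (realizes n B rho (d y).1) (App v u) (q + ev n (d y).2)
      end
  end.

Lemma realizes_good n A rho s (d : dom s) :
  (forall k, good (rho k)) -> good (realizes n A rho d).
Proof.
elim: A rho s d => [k|A IH|A IH|A IHA B IHB|A IHA B IHB] rho s d gr /=.
- exact: gr.
- move=> v q H; split.
    (* Instantiating the quantifier with [ok] already gives a value and its size bound. *)
    by have [] := IH _ _ _ (good_scons good_ok gr) _ _ (H _ good_ok).
  by move=> q' qq' X gX; apply: good_le qq' (H _ gX); apply: IH; apply: good_scons.
- move=> v q H; split.
    (* [ok] is a pre-fixpoint, since realizers are [ok], hence it contains the least one. *)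
    apply: H; split; first exact: good_ok.
    by move=> u r /IH[]//; apply: good_scons => //; apply: good_ok.
  by move=> q' qq' X [gX pX]; apply: good_le qq' _ => //; apply: H.
- move=> v q [okv H]; split=> // q' qq'; split; first by case: (good_ok okv) => _; apply.
  by move=> u r /H; apply: eval_in_le; [apply: IHB | rewrite leq_add2r].
- case: s d => [|s1 s2] d v q // [okv H]; split=> // q' qq'.
  split; first by case: (good_ok okv) => _; apply.
  by move=> u y /H; apply: eval_in_le; [apply: IHB | rewrite leq_add2r].
Qed.

Lemma shape_of_linear A : is_linear A -> shape_of A = Base.
Proof. by elim: A => //= A IHA B IHB /andP[_ /IHB]. Qed.

Lemma shape_of_tren r A : shape_of (tren r A) = shape_of A.
Proof. by elim: A r => //= A IHA B IHB r; rewrite ?IHA IHB. Qed.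

Lemma shape_of_tsubst sg A : (forall k, shape_of (sg k) = Base) ->
  shape_of (tsubst sg A) = shape_of A.
Proof.
elim: A sg => [k|A IH|A IH|A IHA B IHB|A IHA B IHB] sg H //=.
- by apply: IH => -[|k] //=; rewrite shape_of_tren.
- exact: IHB.
- by rewrite IHA // IHB.
Qed.

Lemma shape_of_tinst A L : is_linear L -> shape_of (tinst A L) = shape_of A.
Proof. by move=> /shape_of_linear lL; apply: shape_of_tsubst => -[]. Qed.

(** A formula of shape [Base] never inspects its datum. This passes between the [tt] fixed in the
    clauses of [Mu] and [Lolli] and a datum whose shape is only provably [Base]. *)
Lemma realizes_base n A rho s s' (d : dom s) (d' : dom s') v q :
  shape_of A = Base -> realizes n A rho d v q -> realizes n A rho d' v q.
Proof.
elim: A rho v q => [k|A IH|A IH|A IHA B IHB|A IHA B IHB] rho v q //= bA.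
- by move=> H X gX; apply: IH (H _ gX).
- case=> okv H; split=> // u r /H; apply: eval_in_sub => w p; exact: IHB.
Qed.

(** * Realizability under renaming, substitution and fixpoints *)

Lemma realizes_tren n r A rho rho' s (d : dom s) v q :
  (forall k v q, rho' k v q <-> rho (r k) v q) ->
  realizes n (tren r A) rho d v q <-> realizes n A rho' d v q.
Proof.
elim: A r rho rho' s d v q => [k|A IH|A IH|A IHA B IHB|A IHA B IHB]
  r rho rho' s d v q H /=.
- by split=> /H.
- have HX X : forall k v q, scons X rho' k v q <-> scons X rho (up_ren r k) v q.
    by case=> [|k] /=.
  by split=> K X gX; move: (K X gX); rewrite (IH _ _ _ _ _ _ _ (HX X)).
- have HX X : forall k v q, scons X rho' k v q <-> scons X rho (up_ren r k) v q.
    by case=> [|k] /=.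
  by split=> K X [gX pX]; apply: K; split=> // u p ru; apply: pX; move: ru;
    rewrite (IH _ _ _ _ _ _ _ (HX X)).
- by split=> -[okv K]; split=> // u p /(IHA _ _ _ _ _ _ _ H)/K;
    apply: eval_in_sub => w p' /(IHB _ _ _ _ _ _ _ H).
- case: s d => [|s1 s2] d //.
  by split=> -[okv K]; split=> // u y /(IHA _ _ _ _ _ _ _ H)/K;
    apply: eval_in_sub => w p' /(IHB _ _ _ _ _ _ _ H).
Qed.

Lemma realizes_shift n A X rho s (d : dom s) v q :
  realizes n (tren S A) (scons X rho) d v q <-> realizes n A rho d v q.
Proof. exact: realizes_tren. Qed.

(** Substituted formulas of shape [Base] are each interpreted by one candidate, independent of the
    datum, so they can be stored in the valuation. *)
Lemma realizes_tsubst n sg A rho rho' s (d : dom s) v q :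
  (forall k, shape_of (sg k) = Base) ->
  (forall k v q, rho' k v q <-> @realizes n (sg k) rho Base tt v q) ->
  realizes n (tsubst sg A) rho d v q <-> realizes n A rho' d v q.
Proof.
elim: A sg rho rho' s d v q => [k|A IH|A IH|A IHA B IHB|A IHA B IHB]
  sg rho rho' s d v q bsg H /=.
- by split=> [K|/H K]; [apply/H|]; apply: (realizes_base _ (bsg k) K).
- have bsg' : forall k, shape_of (tup sg k) = Base.
    by case=> //= k; rewrite shape_of_tren.
  have HX X : forall k v q, scons X rho' k v q <->
      @realizes n (tup sg k) (scons X rho) Base tt v q.
    by case=> [|k] u r //=; rewrite realizes_shift.
  by split=> K X gX; move: (K X gX); rewrite (IH _ _ _ _ _ _ _ bsg' (HX X)).
- have bsg' : forall k, shape_of (tup sg k) = Base.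
    by case=> //= k; rewrite shape_of_tren.
  have HX X : forall k v q, scons X rho' k v q <->
      @realizes n (tup sg k) (scons X rho) Base tt v q.
    by case=> [|k] u r //=; rewrite realizes_shift.
  by split=> K X [gX pX]; apply: K; split=> // u p ru; apply: pX; move: ru;
    rewrite (IH _ _ _ _ _ _ _ bsg' (HX X)).
- by split=> -[okv K]; split=> // u p /(IHA _ _ _ _ _ _ _ bsg H)/K;
    apply: eval_in_sub => w p' /(IHB _ _ _ _ _ _ _ bsg H).
- case: s d => [|s1 s2] d //.
  by split=> -[okv K]; split=> // u y /(IHA _ _ _ _ _ _ _ bsg H)/K;
    apply: eval_in_sub => w p' /(IHB _ _ _ _ _ _ _ bsg H).
Qed.

Lemma realizes_tinst n A L rho s (d : dom s) v q : is_linear L ->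
  realizes n (tinst A L) rho d v q <->
  realizes n A (scons (@realizes n L rho Base tt) rho) d v q.
Proof.
by move=> lL; apply: realizes_tsubst => -[|k] //; apply: shape_of_linear.
Qed.

(** Both polarities are proved together because the left of [Lolli] and [Arrow] flips [b]. *)
Lemma realizes_mono n A b k rho rho' s (d : dom s) v q : occurs_only b k A ->
  (forall j, j != k -> forall v q, rho j v q <-> rho' j v q) ->
  (forall v q, rho k v q -> rho' k v q) ->
  if b then realizes n A rho d v q -> realizes n A rho' d v q
  else realizes n A rho' d v q -> realizes n A rho d v q.
Proof.
elim: A b k rho rho' s d v q => [j|A IH|A IH|A IHA B IHB|A IHA B IHB]
  b k rho rho' s d v q /= oA Hj Hk.
- have [ejk|njk] := eqVneq j k; last by case: b {oA} => /(Hj _ njk).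
  by move: oA; rewrite ejk eqxx => /= ->; apply: Hk.
- have HX X : forall j, j != k.+1 -> forall v q,
      scons X rho j v q <-> scons X rho' j v q by case.
  have {}IH X := IH b k.+1 (scons X rho) (scons X rho') s d _ _ oA (HX X) Hk.
  by case: b {oA} IH => IH H X gX; apply: IH; apply: H.
- have HX X : forall j, j != k.+1 -> forall v q,
      scons X rho j v q <-> scons X rho' j v q by case.
  have {}IH X := IH b k.+1 (scons X rho) (scons X rho') Base tt _ _ oA (HX X) Hk.
  by case: b {oA} IH => IH H X [gX pX]; apply: H; split=> // u r ru; apply: pX; apply: IH.
- case/andP: oA => oA oB.
  have {}IHA u r := IHA (~~ b) k rho rho' Base tt u r oA Hj Hk.
  have {}IHB u r := IHB b k rho rho' s d u r oB Hj Hk.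
  by case: b {oA oB} IHA IHB => IHA IHB [okv H]; split=> // u r /IHA/H;
    apply: eval_in_sub.
- case: s d => [|s1 s2] d; first by case: b {oA}.
  case/andP: oA => oA oB.
  have {}IHA e u r := IHA (~~ b) k rho rho' s1 e u r oA Hj Hk.
  have {}IHB e u r := IHB b k rho rho' s2 e u r oB Hj Hk.
  by case: b {oA oB} IHA IHB => IHA IHB [okv H]; split=> // u y /IHA/H;
    apply: eval_in_sub => ? ? /IHB.
Qed.

(* Knaster-Tarski *)
Lemma realizes_mu n A rho s (d : dom s) v q : is_linear (Mu A) ->
  (forall k, good (rho k)) ->
  realizes n (tinst A (Mu A)) rho d v q <-> realizes n (Mu A) rho d v q.
Proof.
move=> lM gr; rewrite realizes_tinst //.
set M := @realizes n (Mu A) rho Base tt; rewrite -/(M v q).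
have /andP[/shape_of_linear bA pA] := lM.
pose F X := @realizes n A (scons X rho) Base tt.
have Fmono (X Y : cand) : (forall v q, X v q -> Y v q) ->
    forall v q, F X v q -> F Y v q.
  move=> XY u r; apply: (@realizes_mono n A true 0) => //.
  by case.
have FM u r : F M u r -> M u r.
  by move=> Fu X [gX pX]; apply: (pX); apply: Fmono Fu => w p Mw; apply: (Mw X).
have gM : good M by apply: realizes_good.
have MF u r : M u r -> F M u r.
  (* [F M] is itself a good pre-fixpoint, by [FM] and monotonicity, so it contains the least one. *)
  move=> Mu; apply: Mu; split; first by apply: realizes_good; apply: good_scons.
  by apply: Fmono.
split=> [H|/MF H]; first by apply: FM; apply: realizes_base H.
by apply: realizes_base H.
Qed.

(** * Polynomial budgets and environments *)

Lemma evD n p q : ev n (p + q)%R = ev n p + ev n q.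
Proof. exact: hornerD. Qed.
Lemma evM n p q : ev n (p * q)%R = ev n p * ev n q.
Proof. exact: hornerM. Qed.
Lemma evX n : ev n 'X%R = n.
Proof. exact: hornerX. Qed.
Lemma evC n m : ev n (polyC m) = m.
Proof. exact: hornerC. Qed.
Lemma ev0 n : ev n 0%R = 0.
Proof. exact: horner0. Qed.
Lemma ev1 n : ev n 1%R = 1.
Proof. exact: evC. Qed.
Lemma ev_sum n (I : Type) (r : seq I) (F : I -> {poly nat}) :
  ev n (\sum_(i <- r) F i)%R = \sum_(i <- r) ev n (F i).
Proof. exact: horner_sum. Qed.

Definition denot (s : shape) : Type := (dom s * {poly nat})%type.

Definition env : Type := nat -> {s : shape & denot s}.

(** Environments are tagged by shape so that their type does not depend on the context; reading at
    another shape gives a default. *)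
Definition get (s : shape) (y : {s : shape & denot s}) : denot s :=
  untag (dom0 s, 0%R) id y.

Lemma getK s (y : denot s) : get s (Tagged denot y) = y.
Proof. by rewrite /get (@untagE _ denot _ _ s id (Tagged denot y) erefl). Qed.

Definition upd (T : Type) (f : nat -> T) (z : nat) (a : T) (n : nat) : T :=
  if n == z then a else f n.

Lemma upd_same T (f : nat -> T) z a : upd f z a z = a.
Proof. by rewrite /upd eqxx. Qed.

Lemma upd_other T (f : nat -> T) z a n : n != z -> upd f z a n = f n.
Proof. by rewrite /upd => /negbTE->. Qed.

Definition ctx_realizes n rho (G : ctx) (g : env) (sg : nat -> term) : Prop :=
  forall x A, (x, A) \in G -> realizes n A rho (get (shape_of A) (g x)).1
    (sg x) (ev n (get (shape_of A) (g x)).2).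

Definition lctx_realizes n rho (D : ctx) (del : nat -> nat) (sg : nat -> term) :
    Prop :=
  forall x L, (x, L) \in D -> @realizes n L rho Base tt (sg x) (del x).

(* The budget of the values of the intuitionistic context may be multiplied,
   that of the linear context is only added. *)
Definition sound (s : shape) (G D : ctx) (t : term) (B : preformula) : Prop :=
  exists F : env -> denot s, forall n rho g del sg, (forall k, good (rho k)) ->
    ctx_realizes n rho G g sg -> lctx_realizes n rho D del sg ->
    eval_in (realizes n B rho (F g).1) (subst sg t) (ev n (F g).2 + csum del D).

(** * Size and cost of applied abstractions *)

Lemma subst_shift v t : subst (scons v Var) (ren S t) = t.
Proof. by rewrite (@subst_ren _ _ Var) // subst_id. Qed.

Lemma lam_step z t sg v : is_value v ->
  step (App (subst sg (lam z t)) v) (subst (upd sg z v) t).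
Proof.
move=> vv; rewrite /lam /=; set t' := subst _ _.
suff -> : subst (upd sg z v) t = subst (scons v Var) t' by apply: step_beta.
rewrite /t' (@subst_ren _ _ (upd (fun n => ren S (sg n)) z (Var 0))); last first.
  by move=> n; rewrite /upd; case: ifP.
apply/esym/subst_subst => n; rewrite /upd; case: ifP => // _.
exact: subst_shift.
Qed.

Lemma tsize_lam z t sg : tsize (subst sg (lam z t)) =
  (wsize (upd (fun n => tsize (sg n)) z 1) t).+1.
Proof.
rewrite (@tsize_subst _ (fun n => tsize (sg n))) //=; congr S.
by apply: wsize_ren => n; rewrite /upd; case: ifP.
Qed.

Lemma tsize_upd z t sg v : tsize (subst (upd sg z v) t) =
  wsize (upd (fun n => tsize (sg n)) z (tsize v)) t.
Proof. by apply: tsize_subst => n; rewrite /upd; case: ifP. Qed.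

Lemma tsize_app t u : tsize (App t u) = tsize t + tsize u.
Proof. by []. Qed.

Lemma lam_cost z t sg v :
  step_cost (App (subst sg (lam z t)) v) (subst (upd sg z v) t) <=
  1 + tsize t * tsize v.
Proof.
rewrite /step_cost tsize_upd tsize_app tsize_lam.
set w := upd _ z (tsize v); set w' := upd _ z 1.
have : wsize w t <= wsize w' t + tsize t * tsize v.
  by apply: wsize_lipschitz => n; rewrite /w /w' /upd; case: ifP; lia.
by lia.
Qed.

Lemma mem_unzip1 x A (G : ctx) : (x, A) \in G -> x \in unzip1 G.
Proof. by move=> H; apply/mapP; exists (x, A). Qed.

Lemma fresh_lin G D z L : distinct G (rcons D (z, L)) ->
  (forall x A, (x, A) \in G -> x != z) /\ (forall x A, (x, A) \in D -> x != z).
Proof.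
rewrite /distinct -rcons_cat /unzip1 map_rcons rcons_uniq => /andP[/= zGD _].
by split=> x A xG; apply: contraNneq zGD => <-; apply: (@mem_unzip1 _ A);
  rewrite mem_cat xG ?orbT.
Qed.

Lemma fresh_int G D z A : distinct (rcons G (z, A)) D ->
  (forall x C, (x, C) \in G -> x != z) /\ (forall x C, (x, C) \in D -> x != z).
Proof.
move=> H; suff : distinct G (rcons D (z, A)) by apply: fresh_lin.
by move: H; rewrite /distinct cat_rcons (@perm_uniq _ _ (unzip1 (G ++ rcons D (z, A))))
   // perm_map // perm_cat2l perm_sym perm_rcons.
Qed.

(** The single possible occurrence of [z] makes the body grow by at most [tsize v], which the redex
    already counts: the term does not grow, and the step has the minimal cost 1. *)
Lemma lam_cost_linear G D z L t B sg v : dial G (rcons D (z, L)) t B ->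
  step_cost (App (subst sg (lam z t)) v) (subst (upd sg z v) t) <= 1.
Proof.
move=> T; rewrite /step_cost tsize_upd tsize_app tsize_lam.
have [fG fD] := fresh_lin (dial_distinct T).
set w := upd _ z (tsize v); set w' := upd _ z 1.
have : wsize w t <= wsize w' t + tsize v.
  apply: leq_trans (wsize_linear (w' := w') T _) _.
    by move=> x A /fG xz; rewrite /w /w' !upd_other.
  rewrite csum_rcons leq_add2l (@csum_eq _ (fun=> 0)) => [|x A /fD xz]; last first.
    by rewrite /w /w' !upd_other // subnn.
  by rewrite /csum big1 // /w upd_same leq_subr.
by lia.
Qed.

Definition ctx_weight (G : ctx) (g : env) : {poly nat} :=
  (\sum_(xA <- G) (get (shape_of xA.2) (g xA.1)).2)%R.

(** The bound of [wsize_ctx] as a polynomial, with sizes replaced by budgets; the linear part is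
    kept apart, in [csum del D]. *)
Definition size_budget (t : term) (G : ctx) (g : env) : {poly nat} :=
  (polyC (tsize t) * (1 + ctx_weight G g))%R.

Lemma tsize_budget G D t B n rho g del sg : dial G D t B ->
  (forall k, good (rho k)) -> ctx_realizes n rho G g sg ->
  lctx_realizes n rho D del sg ->
  tsize (subst sg t) <= ev n (size_budget t G g) + csum del D.
Proof.
move=> T gr HG HD; rewrite (@tsize_subst _ (fun x => tsize (sg x))) //.
apply: leq_trans (wsize_ctx _ T) _; rewrite evM evC evD ev1 ev_sum.
apply: leq_add.
  rewrite leq_mul2l leq_add2l; apply/orP; right.
  rewrite /csum !big_seq; apply: leq_sum => -[x A] /HG H.
  by have [[]] := realizes_good gr H.
by apply: csum_le => x A /HD H; have [[]] := realizes_good gr H.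
Qed.

(** * Environment updates and soundness of the typing rules *)

Lemma ctx_realizes_upd n rho G g sg z A (y : denot (shape_of A)) v :
  (forall x C, (x, C) \in G -> x != z) -> ctx_realizes n rho G g sg ->
  realizes n A rho y.1 v (ev n y.2) ->
  ctx_realizes n rho (rcons G (z, A)) (upd g z (Tagged denot y)) (upd sg z v).
Proof.
move=> fG HG Hv x C; rewrite mem_rcons inE => /orP[/eqP[-> ->]|xG].
  by rewrite !upd_same getK.
by rewrite !upd_other ?(fG _ _ xG) //; apply: HG.
Qed.

Lemma ctx_realizes_fresh n rho G g sg z v :
  (forall x C, (x, C) \in G -> x != z) -> ctx_realizes n rho G g sg ->
  ctx_realizes n rho G g (upd sg z v).
Proof. by move=> fG HG x C xG; rewrite upd_other ?(fG _ _ xG) //; apply: HG. Qed.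

Lemma lctx_realizes_fresh n rho D del sg z v :
  (forall x C, (x, C) \in D -> x != z) -> lctx_realizes n rho D del sg ->
  lctx_realizes n rho D del (upd sg z v).
Proof. by move=> fD HD x C xD; rewrite upd_other ?(fD _ _ xD) //; apply: HD. Qed.

Lemma lctx_realizes_upd n rho D del sg z L v q :
  (forall x C, (x, C) \in D -> x != z) -> lctx_realizes n rho D del sg ->
  @realizes n L rho Base tt v q ->
  lctx_realizes n rho (rcons D (z, L)) (upd del z q) (upd sg z v).
Proof.
move=> fD HD Hv x C; rewrite mem_rcons inE => /orP[/eqP[-> ->]|xD].
  by rewrite !upd_same.
by rewrite !upd_other ?(fD _ _ xD) //; apply: HD.
Qed.

Lemma csum_upd del D z L q : (forall x C, (x, C) \in D -> x != z) ->
  csum (upd del z q) (rcons D (z, L)) = csum del D + q.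
Proof.
move=> fD; rewrite csum_rcons upd_same; congr (_ + _).
by apply: csum_eq => x C /fD xz; rewrite upd_other.
Qed.

Lemma ctx_realizes_sub n rho G G' g sg : {subset G' <= G} ->
  ctx_realizes n rho G g sg -> ctx_realizes n rho G' g sg.
Proof. by move=> sG HG x A /sG; apply: HG. Qed.

Lemma lctx_realizes_sub n rho D D' del sg : {subset D' <= D} ->
  lctx_realizes n rho D del sg -> lctx_realizes n rho D' del sg.
Proof. by move=> sD HD x A /sD; apply: HD. Qed.

Lemma sound_arrowi G D z t A B : dial (rcons G (z, A)) D t B ->
  sound (shape_of B) (rcons G (z, A)) D t B ->
  sound (shape_of (Arrow A B)) G D (lam z t) (Arrow A B).
Proof.
move=> T [F HF].
pose f g (y : denot (shape_of A)) : denot (shape_of B) :=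
  let r := F (upd g z (Tagged denot y)) in
  (* Besides the budget of the body, this pays for the beta step as in [lam_cost], with the budget
     [y.2] bounding the size of the argument. *)
  (r.1, r.2 + (1 + polyC (tsize t) * y.2))%R.
exists (fun g => (f g, size_budget (lam z t) G g)) => n rho g del sg gr HG HD.
have [fG fD] := fresh_int (dial_distinct T).
apply: eval_in_value; first exact: realizes_good.
split; first by split=> //; apply: tsize_budget (dial_arrowi T) _ HG HD.
move=> u y Hu /=; have [[vu su] _] := realizes_good gr Hu.
set q := _ + csum del D.
apply: (@eval_in_le _ _ (1 + tsize t * tsize u +
    (ev n (F (upd g z (Tagged denot y))).2 + csum del D))).
- exact: realizes_good.
- rewrite !evD ev1 evM evC /q; have := leq_mul (leqnn (tsize t)) su; lia.
apply: eval_in_step (lam_step z t sg vu) (lam_cost _ _ _ _) _.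
  exact: realizes_good.
by apply: HF => //; [apply: ctx_realizes_upd | apply: lctx_realizes_fresh].
Qed.

Lemma sound_lollii G D z t L B : dial G (rcons D (z, L)) t B ->
  sound (shape_of B) G (rcons D (z, L)) t B ->
  sound (shape_of B) G D (lam z t) (Lolli L B).
Proof.
move=> T [F HF].
(* The budget of the body, 1 for the linear beta step, and the size of the abstraction itself. *)
exists (fun g => ((F g).1, (F g).2 + 1 + size_budget (lam z t) G g)%R)
  => n rho g del sg gr HG HD.
have [fG fD] := fresh_lin (dial_distinct T).
apply: eval_in_value; first exact: realizes_good.
split.
  split=> //; apply: leq_trans (tsize_budget (dial_lollii T) gr HG HD) _.
  by rewrite !evD; lia.
move=> u r Hu /=; have [[vu su] _] := realizes_good gr Hu.
apply: (@eval_in_le _ _ (1 + (ev n (F g).2 + (csum del D + r)))).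
- exact: realizes_good.
- by rewrite !evD ev1; lia.
apply: eval_in_step (lam_step z t sg vu) (lam_cost_linear _ _ T) _.
  exact: realizes_good.
rewrite -(csum_upd del L r fD).
by apply: HF => //; [apply: ctx_realizes_fresh | apply: lctx_realizes_upd].
Qed.

Lemma sound_arrowe G1 G2 D t u A B :
  sound (shape_of (Arrow A B)) G1 D t (Arrow A B) ->
  sound (shape_of A) G2 [::] u A ->
  sound (shape_of B) (G1 ++ G2) D (App t u) B.
Proof.
move=> [F HF] [K HK].
exists (fun g => let r := (F g).1 (K g) in (r.1, (F g).2 + (K g).2 + r.2)%R)
  => n rho g del sg gr HG HD /=.
have {}HF := HF n rho g del sg gr
  (ctx_realizes_sub (fun x => @mem_catl _ x G1 G2) HG) HD.
have {}HK := HK n rho g del sg gr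
  (ctx_realizes_sub (fun x => @mem_catr _ x G1 G2) HG) (fun x L => ltac:(by [])).
rewrite /csum big_nil addn0 in HK.
set e := ev n ((F g).1 (K g)).2.
have gB : good (realizes n B rho ((F g).1 (K g)).1) by apply: realizes_good.
have -> : ev n ((F g).2 + (K g).2 + ((F g).1 (K g)).2)%R + csum del D =
    ev n (F g).2 + csum del D + ev n (K g).2 + e by rewrite !evD -/e; lia.
apply: eval_in_app HF HK _ => // v w q' r' r'r [_ Hv] Hw.
(* The datum of the function was applied to [K g], so the argument must be presented with its
   original budget, not with what evaluation left of it. *)
have /Hv : realizes n A rho (K g).1 w (ev n (K g).2).
  by apply: good_le r'r Hw; apply: realizes_good.
by apply: eval_in_le => //; rewrite -/e; lia.
Qed.

(** The unspent budgets add up exactly as the clause of [Lolli] asks, hence no extra budget for the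
    call. *)
Lemma sound_lollie G1 G2 D1 D2 t u L B : is_linear L ->
  sound (shape_of B) G1 D1 t (Lolli L B) -> sound (shape_of L) G2 D2 u L ->
  sound (shape_of B) (G1 ++ G2) (D1 ++ D2) (App t u) B.
Proof.
move=> lL [F HF] [K HK].
exists (fun g => ((F g).1, (F g).2 + (K g).2)%R) => n rho g del sg gr HG HD /=.
have {}HF := HF n rho g del sg gr
  (ctx_realizes_sub (fun x => @mem_catl _ x G1 G2) HG)
  (lctx_realizes_sub (fun x => @mem_catl _ x D1 D2) HD).
have {}HK := HK n rho g del sg gr
  (ctx_realizes_sub (fun x => @mem_catr _ x G1 G2) HG)
  (lctx_realizes_sub (fun x => @mem_catr _ x D1 D2) HD).
have gB : good (realizes n B rho (F g).1) by apply: realizes_good.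
rewrite evD csum_cat addnACA -[X in eval_in _ _ X]addn0.
apply: eval_in_app HF HK _ => // v w q' r' _ [_ Hv] Hw.
rewrite addn0; apply: Hv.
by apply: realizes_base Hw; apply: shape_of_linear.
Qed.

(** [x] and [y] both read the entry of [z]. Duplication is already paid for, since [F] may use the
    budget of an intuitionistic variable several times. *)
Lemma sound_contr G D x y z t A B s : distinct (G ++ [:: (x, A); (y, A)]) D ->
  sound s (G ++ [:: (x, A); (y, A)]) D t B ->
  sound s (rcons G (z, A)) D (contract x y z t) B.
Proof.
move=> dG [F HF].
pose r n := if (n == x) || (n == y) then z else n.
exists (fun g => F (fun n => g (r n))) => n rho g del sg gr HG HD /=.
have rK u C : (u, C) \in G ++ D -> r u = u.
  move=> uGD; rewrite /r; case: ifP => // uxy; move: dG.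
  rewrite /distinct (@perm_uniq _ _ (unzip1 ([:: (x, A); (y, A)] ++ G ++ D))); last first.
    by rewrite perm_map // catA perm_cat2r perm_catC.
  rewrite /= inE negb_or -!andbA => /and4P[_ xGD yGD _].
  by case/orP: uxy => /eqP e; move: uGD; rewrite e => /mem_unzip1 H;
    [move: xGD | move: yGD]; rewrite H.
rewrite /contract (@subst_ren _ _ (fun n => sg (r n))) //.
apply: HF => // u C.
- rewrite mem_cat !inE => /orP[uG|/orP[]/eqP[-> ->]].
  + rewrite (@rK _ C) ?mem_cat ?uG //; apply: HG.
    by rewrite mem_rcons inE uG orbT.
  + by rewrite /r eqxx /=; apply: HG; rewrite mem_rcons mem_head.
  + by rewrite /r eqxx orbT /=; apply: HG; rewrite mem_rcons mem_head.
- by move=> uD; rewrite (@rK _ C) ?mem_cat ?uD ?orbT //; apply: HD.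
Qed.

Lemma sound_derel G D x t L B s : is_linear L -> distinct G (rcons D (x, L)) ->
  sound s G (rcons D (x, L)) t B -> sound s (rcons G (x, L)) D t B.
Proof.
move=> lL dG [F HF]; have [fG fD] := fresh_lin dG.
(* The linear budget of [x] becomes the polynomial found in the environment, added once. *)
exists (fun g => ((F g).1, (F g).2 + (get (shape_of L) (g x)).2)%R)
  => n rho g del sg gr HG HD /=.
set p := (get _ _).2.
rewrite evD -addnA [ev n p + _]addnC -(csum_upd del L _ fD); apply: HF => //.
  by apply: ctx_realizes_sub HG => u; rewrite mem_rcons inE orbC => ->.
move=> u C; rewrite mem_rcons inE => /orP[/eqP[-> ->]|uD].
  rewrite upd_same; apply: realizes_base (shape_of_linear lL) (HG x L _).
  by rewrite mem_rcons mem_head.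
by rewrite upd_other ?(fD _ _ uD) //; apply: HD.
Qed.

Theorem soundness G D t B : dial G D t B -> sound (shape_of B) G D t B.
Proof.
elim=> {G D t B}.
- move=> x A _; exists (fun g => get (shape_of A) (g x)).
  move=> n rho g del sg gr HG _ /=; rewrite /csum big_nil addn0.
  apply: eval_in_value; first exact: realizes_good.
  by apply: HG; rewrite mem_head.
- move=> x L lL; exists (fun=> (dom0 _, 0%R)) => n rho g del sg gr _ HD /=.
  rewrite ev0 /csum big_seq1 add0n.
  apply: eval_in_value; first exact: realizes_good.
  by apply: realizes_base (shape_of_linear lL) (HD x L _); rewrite mem_head.
- move=> G D t L T [F HF].
  have lM : is_linear (Mu L) by case: (dial_wf T) => _ _; rewrite /= orbF.
  (* The unfolding has shape [Base] only up to a provable equality, so any datum will do. *)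
  exists (fun g => (dom0 _, (F g).2)) => n rho g del sg gr HG HD /=.
  apply: eval_in_sub (HF n rho g del sg gr HG HD) => v q /(@realizes_mu n L rho _ _ v q lM gr).
  by apply: realizes_base; rewrite shape_of_tinst //; apply: shape_of_linear;
    case/andP: lM.
- move=> G D t L lM T [F HF].
  exists (fun g => (tt, (F g).2)) => n rho g del sg gr HG HD.
  apply: eval_in_sub (HF n rho g del sg gr HG HD) => v q /(@realizes_mu n L rho _ _ v q lM gr).
  exact: realizes_base.
- move=> G D t A T [F HF]; exists F => n rho g del sg gr HG HD.
  (* [F] is chosen before the candidate [X], so one datum and one budget serve all instances. *)
  have := @eval_in_all _ good ok (fun X => realizes n A (scons X rho) (F g).1).
  apply; first exact: good_ok.
  move=> X gX; rewrite -csum_shift; apply: HF; first exact: good_scons.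
    move=> x _ /mem_shift[C -> xG]; rewrite shape_of_tren realizes_shift.
    exact: HG.
  by move=> x _ /mem_shift[C -> xD]; rewrite realizes_shift; apply: HD.
- move=> G D t A L lL T [F HF]; rewrite shape_of_tinst //.
  exists F => n rho g del sg gr HG HD.
  apply: eval_in_sub (HF n rho g del sg gr HG HD) => v q Hv.
  by apply/realizes_tinst => //; apply: Hv; apply: realizes_good.
- by move=> G1 G2 D t u A B _ _ + _; apply: sound_arrowe.
- by move=> G D z t A B; apply: sound_arrowi.
- move=> G1 G2 D1 D2 t u L B _ T IHt _ IHu.
  apply: (@sound_lollie _ _ _ _ _ _ L B _ IHt IHu).
  by case: (dial_wf T) => _ _ /= /orP[]/andP[].
- by move=> G D z t L B; apply: sound_lollii.
- by move=> G D x y z t A B _ T; apply: sound_contr; apply: dial_distinct T.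
- move=> G D x t L B T; apply: sound_derel (dial_distinct T).
  by case: (dial_wf T) => _; rewrite /unzip2 map_rcons all_rcons => /andP[].
- move=> G G' D D' t B _ _ _ _ [F HF]; exists F => n rho g del sg gr HG HD.
  apply: eval_in_le (HF n rho g del sg gr _ _).
  + exact: realizes_good.
  + by rewrite csum_cat addnA leq_addr.
  + by apply: ctx_realizes_sub HG => x; apply: mem_catl.
  + by apply: lctx_realizes_sub HD => x; apply: mem_catl.
- move=> G G' D D' t B pG pD _ [F HF]; exists F => n rho g del sg gr HG HD.
  rewrite -(csum_perm _ pD); apply: HF => //.
  + by apply: ctx_realizes_sub HG => x; rewrite (perm_mem pG).
  + by apply: lctx_realizes_sub HD => x; rewrite (perm_mem pD).
Qed.

(** * Church numerals as realizers *)

Lemma realizes_all n A rho s (d : dom s) v q :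
  (forall X, good X -> realizes n A (scons X rho) d v q) ->
  realizes n (All A) rho d v q.
Proof. by []. Qed.

Lemma realizes_arrow n A B rho s1 s2 (d : dom (Fun s1 s2)) v q : ok v q ->
  (forall u (y : denot s1), realizes n A rho y.1 u (ev n y.2) ->
    eval_in (realizes n B rho (d y).1) (App v u) (q + ev n (d y).2)) ->
  realizes n (Arrow A B) rho d v q.
Proof. by split. Qed.

Lemma realizes_lolli n A B rho s (d : dom s) v q : ok v q ->
  (forall u r, @realizes n A rho Base tt u r ->
    eval_in (realizes n B rho d) (App v u) (q + r)) ->
  realizes n (Lolli A B) rho d v q.
Proof. by split. Qed.

Lemma subst_var r s t : (forall n, s n = Var (r n)) -> subst s t = ren r t.
Proof.
elim: t r s => [n|t IH|t IHt u IHu] r s H /=; first exact: H.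
- by rewrite (IH (up_ren r)) // => -[|n] //=; rewrite H.
- by rewrite (IHt r) // (IHu r).
Qed.

Lemma tsize_beta t v :
  tsize (subst (scons v Var) t) <= tsize t + tsize t * tsize v.
Proof.
rewrite (@tsize_subst _ (fun n => tsize (scons v Var n))) //.
rewrite -{1}(@wsize1 (fun=> 1)) //.
by apply: wsize_lipschitz => -[|n] /=; lia.
Qed.

Lemma beta_cost t v :
  step_cost (App (Lam t) v) (subst (scons v Var) t) <= 1 + tsize t * tsize v.
Proof. by rewrite /step_cost /=; have := tsize_beta t v; lia. Qed.

Definition word_app (f0 f1 x : term) (w : seq bool) : term :=
  foldr (fun (i : bool) u => App (if i then f1 else f0) u) x w.

Lemma churchE w :
  church w = Lam (Lam (Lam (word_app (Var 2) (Var 1) (Var 0) w))).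
Proof. by congr (Lam (Lam (Lam _))); elim: w => //= -[] w ->. Qed.

Lemma subst_word_app s f0 f1 x w : subst s (word_app f0 f1 x w) =
  word_app (subst s f0) (subst s f1) (subst s x) w.
Proof. by elim: w => //= -[] w ->. Qed.

Lemma tsize_word_var x y z w :
  tsize (word_app (Var x) (Var y) (Var z) w) = (size w).+1.
Proof. by elim: w => //= -[] w ->. Qed.

(** The base of the iteration occurs exactly once, so the third beta step of a numeral does not
    increase the size. *)
Lemma tsize_word_app f0 f1 x w : tsize (word_app f0 f1 x w) + 1 =
  tsize (word_app (ren S f0) (ren S f1) (Var 0) w) + tsize x.
Proof.
elim: w => [|i w IH] /=; first by rewrite addnC.
by rewrite -!addnA IH !addnA; case: i; rewrite tsize_ren.
Qed.

(** Each letter uses one copy of [f0] or [f1], whose budget is at most [p0 + p1]. *)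
Lemma eval_word_app n rho f0 f1 x p0 p1 r w : (forall k, good (rho k)) ->
  let E := Lolli (TVar 0) (TVar 0) in
  @realizes n E rho Base tt f0 p0 -> @realizes n E rho Base tt f1 p1 ->
  rho 0 x r -> eval_in (rho 0) (word_app f0 f1 x w) (size w * (p0 + p1) + r).
Proof.
move=> gr E H0 H1 Hx; elim: w => [|i w IH]; first exact: eval_in_value.
have Hi : eval_in (@realizes n E rho Base tt) (if i then f1 else f0)
    (if i then p1 else p0).
  by case: i; apply: eval_in_value => //; apply: realizes_good.
apply: (@eval_in_le _ _ ((if i then p1 else p0) + (size w * (p0 + p1) + r) + 0)).
- exact: gr.
- by case: i {Hi} => /=; lia.
apply: eval_in_app Hi IH _ => // v y q' r' _ [_ Hv] Hy.
by rewrite addn0; apply: Hv.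
Qed.

(** The last component, ['X + 4], is the size of the numeral. Each call to a step function adds its
    beta cost and the growth in size; the second also adds ['X * (y0.2 + y1.2)] for the iteration
    and 1 for the final, linear beta step. *)
Definition church_denot : denot (shape_of W_Church) :=
  (fun y0 =>
    (fun y1 =>
      (tt, (('X + 3%:P) * (1 + y0.2) * (2%:P * y1.2 + 1) +
            'X * (y0.2 + y1.2) + 2%:P)%R),
     (1 + 2%:P * ('X + 3%:P) * y0.2)%R),
   ('X + 4%:P)%R).

Definition evE := (evD, evM, ev1, evX, evC).

Lemma church_realizes rho w : (forall k, good (rho k)) ->
  realizes (size w) W_Church rho church_denot.1 (church w)
    (ev (size w) church_denot.2).
Proof.
move=> gr; pose E := Lolli (TVar 0) (TVar 0).
rewrite -[realizes _ _ _ _]/(@realizes (size w) (All (Arrow E (Arrow E E))) rho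
  (Fun Base (Fun Base Base)) church_denot.1); apply: realizes_all => X gX; set n := size w.
have gr' := good_scons gX gr.
rewrite churchE; set b := word_app _ _ _ _; have sb : tsize b = n.+1.
  exact: tsize_word_var.
apply: realizes_arrow; first by split=> //=; rewrite !evE sb; lia.
move=> u0 [[] p0] H0; set P0 := ev n p0 in H0.
have [[vu0 su0] _] := realizes_good gr' H0.
set b1 := word_app (ren S (ren S u0)) (Var 1) (Var 0) w.
have eb1 : Lam (Lam b1) = subst (scons u0 Var) (Lam (Lam b)).
  by rewrite /= /b subst_word_app.
have m1 : tsize (Lam (Lam b)) * tsize u0 <= (n + 3) * P0.
  by rewrite /= sb; apply: leq_mul => //; lia.
have s1 : tsize (Lam (Lam b1)) <= (n + 3) * (1 + P0).
  rewrite eb1; apply: leq_trans (tsize_beta _ _) _.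
  by move: m1; rewrite /= sb; lia.
have c1 : step_cost (App (Lam (Lam (Lam b))) u0) (Lam (Lam b1)) <=
    1 + (n + 3) * P0.
  by rewrite eb1; apply: leq_trans (beta_cost _ _) _; rewrite leq_add2l.
have st1 : step (App (Lam (Lam (Lam b))) u0) (Lam (Lam b1)).
  by rewrite eb1; apply: step_beta.
(* The budget splits into the cost [c1] of the first beta step and a remainder covering the size
   bound [s1]. *)
have -> : ev n church_denot.2 + ev n (church_denot.1 (tt, p0)).2 =
    1 + (n + 3) * P0 + ((n + 3) * (1 + P0) + 1).
  by rewrite /= !evE -/P0; lia.
apply: eval_in_step st1 c1 _; first exact: realizes_good.
apply: eval_in_value; first exact: realizes_good.
apply: realizes_arrow; first by split=> //; lia.
move=> u1 [[] p1] H1; set P1 := ev n p1 in H1.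
have [[vu1 su1] _] := realizes_good gr' H1.
set b2 := word_app (ren S u0) (ren S u1) (Var 0) w.
have eb2 : Lam b2 = subst (scons u1 Var) (Lam b1).
  rewrite /= /b1 subst_word_app /b2 /=; congr (Lam (word_app _ _ _ _)).
  rewrite (@subst_ren _ _ (fun n => up (scons u1 Var) n.+1)) //.
  by rewrite (@subst_ren _ _ (fun n => Var n.+1)) // (@subst_var S).
have m2 : tsize (Lam b1) * tsize u1 <= (n + 3) * (1 + P0) * P1.
  by apply: leq_mul => //; apply: leq_trans s1; rewrite /=; lia.
have s2 : tsize (Lam b2) <= (n + 3) * (1 + P0) * (1 + P1).
  rewrite eb2; apply: leq_trans (tsize_beta _ _) _.
  by move: m2 s1; rewrite /=; lia.
have c2 : step_cost (App (Lam (Lam b1)) u1) (Lam b2) <=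
    1 + (n + 3) * (1 + P0) * P1.
  by rewrite eb2; apply: leq_trans (beta_cost _ _) _; rewrite leq_add2l.
have st2 : step (App (Lam (Lam b1)) u1) (Lam b2).
  by rewrite eb2; apply: step_beta.
(* In order: the cost [c2], the size bound [s2], the iteration, and the last beta step. *)
apply: (@eval_in_le _ _ (1 + (n + 3) * (1 + P0) * P1 +
    ((n + 3) * (1 + P0) * (1 + P1) + n * (P0 + P1) + 1))).
- exact: realizes_good.
- by rewrite /= !evE -/P0 -/P1; lia.
apply: eval_in_step st2 c2 _; first exact: realizes_good.
apply: eval_in_value; first exact: realizes_good.
apply: realizes_lolli; first by split=> //; lia.
move=> x r Hx; have [[vx _] _] := gX _ _ Hx.
have eb3 : word_app u0 u1 x w = subst (scons x Var) b2.
  by rewrite /b2 subst_word_app !subst_shift.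
apply: (@eval_in_le _ _ (1 + (n * (P0 + P1) + r))); [exact: gX|lia|].
apply: (@eval_in_step _ _ (word_app u0 u1 x w)) => //.
- by rewrite eb3; apply: step_beta.
- by rewrite /step_cost /=; have := tsize_word_app u0 u1 x w; rewrite -/b2; lia.
exact: (@eval_word_app n (scons X rho)).
Qed.

(** * The polynomial bound on evaluation time *)

Theorem theorem5 (L : preformula) (t : term) (linL : is_linear L)
    (tT : dial [::] [::] t (Arrow W_Church L)) :
  exists P : {poly nat}, forall w : seq bool,
    converges (App t (church w)) /\
    (forall k : nat, Time (App t (church w)) k -> k <= (P.[size w])%R).
Proof.
have [F HF] := soundness tT.
pose g : env := fun=> Tagged denot (dom0 Base, 0%R : {poly nat}).
pose y := (F g).1 church_denot.
(* The budgets of [t], of the numeral and of the call. None depends on [w], which enters only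
   through evaluation at its length; [g] is arbitrary, as the contexts are empty. *)
exists ((F g).2 + church_denot.2 + y.2)%R => w.
set P := (_ + _)%R; rewrite -[(P.[_])%R]/(ev (size w) P).
pose rho (k : nat) : cand := ok.
have gr k : good (rho k) by apply: good_ok.
have := HF (size w) rho g (fun=> 0) Var gr (fun x A => ltac:(by [])) (fun x A => ltac:(by [])).
rewrite subst_id // /csum big_nil addn0 => Ht.
have Hw := church_realizes w gr.
have : eval_in (realizes (size w) L rho y.1) (App t (church w)) (ev (size w) P).
  rewrite evD evD; apply: eval_in_app Ht (eval_in_value _ Hw) _.
  - exact: realizes_good.
  - exact: realizes_good.
  move=> v u q' r' r'r [_ Hv] Hu.
  have /Hv : realizes (size w) W_Church rho church_denot.1 u (ev (size w) church_denot.2).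
    by apply: good_le r'r Hu; apply: realizes_good.
  by apply: eval_in_le; [exact: realizes_good | rewrite -/y; lia].
case=> v [k [vv r kP _]]; split; first by exists v, k.
by move=> k' Tk'; rewrite (Time_unique Tk' (ex_intro _ v (conj vv r))).
Qed.
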